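(* Let $\psi:\mathbb{R}^d\to\mathbb{R}\cup\{-\infty\}$ be a $\Lambda_0$-concave function with $\Lambda_0$-conjugate $\psi^0$, and define the exponentially concave function $\varphi$ on $\Omega_0$ by $$\varphi(\mu)=\inf_{\theta\in\mathbb{R}^d}\left[\log\mu\left(e^{-\langle\theta,x\rangle}\right)-\psi^0(\theta)\right],\qquad\mu\in\Omega_0 .$$ Let $\alpha\in\mathbb{R}^d$ and let $\theta\in\mathbb{R}^d$ be such that $(\alpha,\theta)\in\partial^{\Lambda_0}\psi$. Then there exists an element $\mu_\alpha^*\in\mathcal{V}^*$ such that $\mu_\alpha^*$ is a supergradient of $\varphi$ at $\mu_\alpha$ and, for every $\nu\in\mathcal{V}$, $\langle\mu_\alpha^*,\nu\rangle=\nu(h_\alpha)$, where $$h_\alpha(x):=\exp\left(-\langle\theta,x\rangle-\Lambda_0(\alpha-\theta)+\Lambda_0(\alpha)\right),\qquad x\in\mathbb{R}^d .$$ In particular, the probability measure $\pi_\alpha\in\Omega_0$ that represents $\mu_\alpha^*$ in the sense that $$\langle\mu_\alpha^*,\nu\rangle=\pi_\alpha\left(\frac{d\nu}{d\mu_\alpha}\right)\quad\text{for all }\nu\in\mathcal{V}\text{ with }\nu\ll\mu_\alpha$$ (for any version of the density $d\nu/d\mu_\alpha$) is given by $\pi_\alpha=\mu_{\alpha-\theta}$.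
   Context: Fix $d\in\mathbb{N}$ and a Borel probability measure $\mu_0$ on $\mathbb{R}^d$ (the base measure). For a (signed) measure $\mu$ and a function $f$, $\mu(f)$ or $\mu(f(x))$ denotes the integral $\int f\,d\mu$. Let $\Lambda_0(\theta)=\log\mu_0(e^{\langle\theta,x\rangle})$, $\theta\in\mathbb{R}^d$, be the cumulant generating function of $\mu_0$; it is assumed that $\Lambda_0(\theta)<\infty$ for all $\theta\in\mathbb{R}^d$. $\Omega_0$ is the convex set of Borel probability measures on $\mathbb{R}^d$ that are absolutely continuous with respect to $\mu_0$. For $\alpha\in\mathbb{R}^d$, $\mu_\alpha\in\Omega_0$ is the probability measure with $\frac{d\mu_\alpha}{d\mu_0}(x)=\exp(\langle\alpha,x\rangle-\Lambda_0(\alpha))$. A function $\psi:\mathbb{R}^d\to\mathbb{R}\cup\{-\infty\}$ is $\Lambda_0$-concave if $\psi(x)=\inf_{y\in\mathbb{R}^d}[\Lambda_0(x-y)-\rho(y)]$ for all $x$, for some $\rho:\mathbb{R}^d\to\mathbb{R}\cup\{-\infty\}$. Its $\Lambda_0$-conjugate is $\psi^0(y)=\inf_{x\in\mathbb{R}^d}[\Lambda_0(x-y)-\psi(x)]$. The $\Lambda_0$-superdifferential $\partial^{\Lambda_0}\psi$ is the set of pairs $(\alpha,y)\in\mathbb{R}^d\times\mathbb{R}^d$ such that $$\psi(v)\le\psi(\alpha)+\Lambda_0(v-y)-\Lambda_0(\alpha-y)\quad\text{for all }v\in\mathbb{R}^d .$$ A function $\varphi$ on a convex set of probability measures is exponentially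 concave if $\exp(\varphi)$ is a nonnegative concave function on that set. Functions on $\Omega_0$ may take values in $[-\infty,+\infty]$, with the convention $(+\infty)-(+\infty)=-\infty$ (needed only when $\psi\equiv-\infty$). $\mathcal{V}$ is the vector space of finite signed Borel measures $\nu$ on $\mathbb{R}^d$ such that $p^{(i)}_j(\nu):=|\nu|(e^{j|x_i|})<\infty$ for all $i\in\{1,\dots,d\}$ and all integers $j\ge0$, where $|\nu|$ is the total variation measure of $\nu$. It carries the locally convex topology $\mathcal{E}$ generated by the seminorms $p^{(i)}_j$, and $\mathcal{V}^*$ is the space of $\mathcal{E}$-continuous linear functionals on $\mathcal{V}$, with pairing $\langle\cdot,\cdot\rangle$. Every $\mu_\alpha$ belongs to $\mathcal{V}$. An element $\mu^*\in\mathcal{V}^*$ is a supergradient of $\varphi$ at $\mu\in\Omega_0\cap\mathcal{V}$ if $\varphi(\nu)\le\varphi(\mu)+\langle\mu^*,\nu-\mu\rangle$ for all $\nu\in\Omega_0\cap\mathcal{V}$. *)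

(* Defs.v *)
From HB Require Import structures.
From mathcomp Require Import all_boot all_order all_algebra.
From mathcomp Require Import all_classical all_reals all_analysis.
From mathcomp Require Import measurable_realfun.

Set Implicit Arguments.
Unset Strict Implicit.
Unset Printing Implicit Defensive.

Import Order.TTheory GRing.Theory Num.Theory.
Import numFieldNormedType.Exports.

Local Open Scope classical_set_scope.
Local Open Scope ring_scope.
Local Open Scope ereal_scope.

(** [R^d] is ['rV[R]_d]; [Rd R d] is the same type with its Borel sigma-algebra. *)
Notation Rd R d := (g_sigma_algebraType (@open 'rV[R]_d)).

Definition dot (R : realType) (d : nat) (a x : 'rV[R]_d) : R :=
  (\sum_(i < d) a ord0 i * x ord0 i)%R.

Section borel_Rd.
Context (R : realType) (d : nat).

Lemma measurable_coord (i : 'I_d) :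
  measurable_fun setT (fun x : Rd R d => x ord0 i : R).
Proof.
apply: (measurability _ (RGenOpens.measurableE R)).
move=> _ [_ [a [b ->] <-]]; rewrite setTI; apply: sub_sigma_algebra.
have /continuousP := @coord_continuous R 1 d ord0 i.
by apply; exact: interval_open.
Qed.

Lemma measurable_dot (a : 'rV[R]_d) :
  measurable_fun setT (fun x : Rd R d => dot a x).
Proof.
apply: measurable_sum => i; apply: measurable_funM => //.
exact: measurable_coord.
Qed.

End borel_Rd.

Section signed_measures.
Context (d0 : measure_display) (T : measurableType d0) (R : realType).
Implicit Type nu : {charge set T -> \bar R}.

Definition hahn_pos nu : set T := sval (cid (Hahn_decomposition nu)).
Definition hahn_neg nu : set T := sval (cid (svalP (cid (Hahn_decomposition nu)))).

Lemma hahnP nu : hahn_decomposition nu (hahn_pos nu) (hahn_neg nu).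
Proof. exact: svalP (cid (svalP (cid (Hahn_decomposition nu)))). Qed.

Definition total_variation nu : {measure set T -> \bar R} :=
  charge_variation (hahnP nu).

(** For a measurable [f] the value is a real number if and only if [f] is
    [|nu|]-integrable, since [+oo - +oo = -oo] in [\bar R]. *)
Definition charge_integral nu (f : T -> \bar R) : \bar R :=
  \int[jordan_pos (hahnP nu)]_x f x - \int[jordan_neg (hahnP nu)]_x f x.

Lemma total_variation_le nu (m : {measure set T -> \bar R}) :
  (forall A, measurable A -> `|nu A| <= m A) ->
  forall A, measurable A -> total_variation nu A <= m A.
Proof.
move=> num A mA; have [[mP _] [mN _] PN PN0] := hahnP nu.
have -> : total_variation nu A =
    nu (A `&` hahn_pos nu) - nu (A `&` hahn_neg nu).
  rewrite -[LHS]/(jordan_pos (hahnP nu) A + jordan_neg (hahnP nu) A).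
  rewrite jordan_posE cjordan_posE jordan_negE cjordan_negE.
  by rewrite /crestr0 mem_set.
have mAP : measurable (A `&` hahn_pos nu) by exact: measurableI.
have mAN : measurable (A `&` hahn_neg nu) by exact: measurableI.
have -> : m A = m (A `&` hahn_pos nu) + m (A `&` hahn_neg nu).
  rewrite -measureU//; first by rewrite -setIUr PN setIT.
  by rewrite setIACA PN0 setI0.
apply: leeD.
  by apply: le_trans (num _ mAP); exact: lee_abs.
by apply: le_trans (num _ mAN); rewrite -abseN; exact: lee_abs.
Qed.

Lemma abse_total_variation nu A :
  measurable A -> `|nu A| <= total_variation nu A.
Proof. exact: abse_charge_variation. Qed.

End signed_measures.

Section seminorms.
Context (R : realType) (d : nat).
Implicit Type nu : {charge set (Rd R d) -> \bar R}.

Definition pV (i : 'I_d) (j : nat) nu : \bar R :=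
  \int[total_variation nu]_x (expR (j%:R * `|x ord0 i|))%:E.

Lemma measurable_expV (i : 'I_d) (j : nat) :
  measurable_fun setT (fun x : Rd R d => (expR (j%:R * `|x ord0 i|))%:E).
Proof.
apply/measurable_EFinP; apply: measurableT_comp => //.
apply: measurable_funM => //; apply: measurableT_comp => //.
exact: measurable_coord.
Qed.

Lemma pV_zero i j : pV i j czero = 0.
Proof.
apply/eqP; rewrite eq_le integral_ge0 ?andbT; last first.
  by move=> x _; rewrite lee_fin expR_ge0.
rewrite -[leRHS](integral_measure_zero [set: Rd R d]
  (fun x => (expR (j%:R * `|x ord0 i|))%:E)).
apply: ge0_le_measure_integral => //.
- apply: total_variation_le => A mA.
  by rewrite /= normr0.
- exact: measurable_expV.
Qed.

Lemma pV_add i j nu1 nu2 : pV i j (cadd nu1 nu2) <= pV i j nu1 + pV i j nu2.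
Proof.
rewrite /pV -ge0_integral_measure_add//; last exact: measurable_expV.
apply: ge0_le_measure_integral => //.
- apply: total_variation_le => A mA.
  rewrite -[leRHS]/(measure_add _ _ A) measure_addE.
  apply: le_trans (lee_abs_add _ _) _.
  by apply: leeD; exact: abse_total_variation.
- exact: measurable_expV.
Qed.

Lemma pV_scale i j (r : R) nu : pV i j (cscale r nu) <= `|r|%:E * pV i j nu.
Proof.
rewrite /pV.
have := @ge0_integral_mscale _ (Rd R d) R (total_variation nu) setT measurableT
  (NngNum (normr_ge0 r)) (fun x => (expR (j%:R * `|x ord0 i|))%:E)
  (measurable_expV i j).
move=> /= <-; last by move=> x _; rewrite lee_fin expR_ge0.
apply: ge0_le_measure_integral => //.
- apply: total_variation_le => A mA.
  rewrite /mscale /cscale /= abseM /= lee_wpmul2l//.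
  exact: abse_total_variation.
- exact: measurable_expV.
Qed.

End seminorms.

(** The space [V]. A charge is a function on all subsets of [R^d] that is
    constrained on the measurable ones only; [V_junk] normalizes the remaining
    values, so that equality in [V] is equality on the Borel sets. *)
Record V (R : realType) (d : nat) := MkV {
  V_charge :> {charge set (Rd R d) -> \bar R} ;
  V_junk : forall A, ~ measurable A -> V_charge A = 0 ;
  V_lty : forall i j, pV i j V_charge < +oo }.

Section V_lmodule.
Context (R : realType) (d : nat).
Local Notation V := (V R d).
Implicit Types nu : V.

Lemma V_fin_num nu A : nu A \is a fin_num.
Proof.
have [mA|mA] := pselect (measurable A); first exact: fin_num_measure.
by rewrite V_junk.
Qed.

Lemma V_ext nu1 nu2 : (forall A, nu1 A = nu2 A) -> nu1 = nu2.
Proof.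
case: nu1 nu2 => [c1 j1 l1] [c2 j2 l2] /= c12.
have c12f : c1 = c2 :> (set (Rd R d) -> \bar R) by exact/funext.
have {c12 c12f} cE : c1 = c2.
  move: c1 c2 {j1 l1 j2 l2 c12} c12f.
  move=> [f1 [[a1] [b1] [e1]]] [f2 [[a2] [b2] [e2]]] /= fE.
  subst f2.
  by rewrite (Prop_irrelevance a2 a1) (Prop_irrelevance b2 b1)
             (Prop_irrelevance e2 e1).
subst c2; congr MkV; exact: Prop_irrelevance.
Qed.

HB.instance Definition _ := gen_eqMixin V.
HB.instance Definition _ := gen_choiceMixin V.

Let czero_junk A : ~ measurable A -> (czero : set (Rd R d) -> \bar R) A = 0.
Proof. by []. Qed.

Let czero_lty i j : pV i j (czero : {charge set (Rd R d) -> \bar R}) < +oo.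
Proof. by rewrite pV_zero. Qed.

Definition V0 : V := @MkV R d czero czero_junk czero_lty.

Let cadd_junk nu1 nu2 A : ~ measurable A -> cadd nu1 nu2 A = 0.
Proof. by move=> mA; rewrite /cadd !V_junk// adde0. Qed.

Let cadd_lty nu1 nu2 i j : pV i j (cadd nu1 nu2) < +oo.
Proof. by apply: le_lt_trans (pV_add _ _ _ _) _; rewrite lte_add_pinfty ?V_lty. Qed.

Definition V_add nu1 nu2 : V := MkV (@cadd_junk nu1 nu2) (cadd_lty nu1 nu2).

Let cscale_junk (r : R) nu A : ~ measurable A -> cscale r nu A = 0.
Proof. by move=> mA; rewrite /cscale V_junk// mule0. Qed.

Let cscale_lty (r : R) nu i j : pV i j (cscale r nu) < +oo.
Proof.
apply: le_lt_trans (pV_scale _ _ _ _) _; rewrite lte_mul_pinfty//.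
exact: V_lty.
Qed.

Definition V_scale (r : R) nu : V := MkV (@cscale_junk r nu) (cscale_lty r nu).

Definition V_opp nu : V := V_scale (-1) nu.

Let V_addA : associative V_add.
Proof. by move=> x y z; apply: V_ext => A /=; rewrite /cadd/= addeA. Qed.

Let V_addC : commutative V_add.
Proof. by move=> x y; apply: V_ext => A /=; rewrite /cadd/= addeC. Qed.

Let V_add0 : left_id V0 V_add.
Proof. by move=> x; apply: V_ext => A /=; rewrite /cadd/= add0e. Qed.

Let V_addN : left_inverse V0 V_opp V_add.
Proof.
move=> x; apply: V_ext => A /=; rewrite /cadd/= /cscale mulN1e addeC.
by rewrite subee// V_fin_num.
Qed.

HB.instance Definition _ :=
  GRing.isZmodule.Build V V_addA V_addC V_add0 V_addN.

Let V_scaleA a b nu : V_scale a (V_scale b nu) = V_scale (a * b)%R nu.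
Proof. by apply: V_ext => A /=; rewrite /cscale/= /cscale EFinM muleA. Qed.

Let V_scale1 : left_id 1%R V_scale.
Proof. by move=> x; apply: V_ext => A /=; rewrite /cscale mul1e. Qed.

Let V_scaleDr : right_distributive V_scale +%R.
Proof.
move=> a x y; apply: V_ext => A /=; rewrite /cscale/= /cadd/= /cscale.
by rewrite muleDr// fin_num_adde_defl// V_fin_num.
Qed.

Let V_scaleDl nu : {morph V_scale^~ nu : a b / (a + b)%R}.
Proof.
move=> a b; apply: V_ext => A /=; rewrite /cscale/= /cadd/= /cscale.
by rewrite EFinD -(fineK (V_fin_num nu A)) -!EFinM -!EFinD mulrDl.
Qed.

HB.instance Definition _ := GRing.Zmodule_isLmodule.Build R V
  V_scaleA V_scale1 V_scaleDr V_scaleDl.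

(** The topology [E]: its subbase consists of the balls of the seminorms. *)
Definition V_subbase : set (set V) :=
  [set B | exists (i : 'I_d) (j : nat) (nu0 : V) (e : R), (0 < e)%R /\
     B = [set nu : V | pV i j (nu - nu0)%R < e%:E]].

HB.instance Definition _ := isSubBaseTopological.Build V V_subbase id.

End V_lmodule.

Section exponential_family.
Context (R : realType) (d : nat) (mu0 : probability (Rd R d) R).

Definition Lambda0 (theta : 'rV[R]_d) : \bar R :=
  lne (\int[mu0]_x (expR (dot theta x))%:E).

Definition tilt_density (alpha : 'rV[R]_d) (x : Rd R d) : \bar R :=
  expeR ((dot alpha x)%:E - Lambda0 alpha).

Definition Omega0 : set (probability (Rd R d) R) := [set mu | mu `<< mu0].

Hypothesis Lambda0_lty : forall theta, Lambda0 theta < +oo.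

Lemma expint_gt0 theta : 0 < \int[mu0]_x (expR (dot theta x))%:E.
Proof.
have mf : measurable_fun setT (fun x : Rd R d => (expR (dot theta x))%:E).
  apply/measurable_EFinP; apply: measurableT_comp => //.
  exact: measurable_dot.
rewrite lt0e integral_ge0 ?andbT; last by move=> x _; rewrite lee_fin expR_ge0.
apply/eqP => I0.
have /(ae_eq_integral_abs mu0 measurableT mf) :
    \int[mu0]_x `|(expR (dot theta x))%:E| = 0.
  rewrite -[RHS]I0; apply: eq_integral => x _.
  by rewrite gee0_abs// lee_fin expR_ge0.
move=> [N [mN N0 sN]].
have : mu0 setT = 0.
  apply: (subset_measure0 _ mN _ N0) => // x _; apply: sN => /= /(_ I).
  by move=> /eqP; rewrite eqe expR_eq0.
by rewrite probability_setT => /eqP; rewrite onee_eq0.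
Qed.

Lemma expint_Lambda0 theta :
  \int[mu0]_x (expR (dot theta x))%:E = expeR (Lambda0 theta).
Proof. by rewrite /Lambda0 lneK// in_itv/= leey ltW ?expint_gt0. Qed.

Lemma Lambda0_fin_num theta : Lambda0 theta \is a fin_num.
Proof.
rewrite fin_numElt Lambda0_lty andbT ltNye; apply/eqP => L.
by have := expint_gt0 theta; rewrite expint_Lambda0 L /= ltxx.
Qed.

Lemma measurable_tilt_density alpha : measurable_fun setT (tilt_density alpha).
Proof.
have -> : tilt_density alpha =
    fun x => (expR (dot alpha x - fine (Lambda0 alpha)))%:E.
  apply/funext => x.
  by rewrite /tilt_density -(fineK (Lambda0_fin_num alpha)) -EFinB.
apply/measurable_EFinP; apply: measurableT_comp => //.
by apply: measurable_funB => //; exact: measurable_dot.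
Qed.

(** The unused argument makes the assumption on [Lambda0] available to the
    instances below: total mass one needs it. *)
Definition tilt_fun (alpha : 'rV[R]_d)
    of (forall theta, Lambda0 theta < +oo) : set (Rd R d) -> \bar R :=
  fun A => \int[mu0]_(x in A) tilt_density alpha x.

Section tilt_instances.
Variable alpha : 'rV[R]_d.
Local Notation nu := (tilt_fun alpha Lambda0_lty).

Let tilt0 : nu set0 = 0. Proof. exact: integral_set0. Qed.

Let tilt_ge0 A : 0 <= nu A.
Proof. by apply: integral_ge0 => x _; exact: expeR_ge0. Qed.

Let tilt_sigma_additive : semi_sigma_additive nu.
Proof.
apply: semi_sigma_additive_nng_induced; first exact: measurable_tilt_density.
by move=> x; exact: expeR_ge0.
Qed.

HB.instance Definition _ :=
  isMeasure.Build _ _ _ nu tilt0 tilt_ge0 tilt_sigma_additive.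

Let tilt_setT : nu setT = 1.
Proof.
rewrite /tilt_fun; have LE := fineK (Lambda0_fin_num alpha).
transitivity (\int[mu0]_x
    ((expR (- fine (Lambda0 alpha)))%:E * (expR (dot alpha x))%:E)).
  apply: eq_integral => x _.
  by rewrite /tilt_density -LE -EFinB /= expRD mulrC.
rewrite ge0_integralZl//=.
- by rewrite expint_Lambda0 -[in X in _ * X]LE /= -EFinM -expRD addNr expR0.
- apply/measurable_EFinP; apply: measurableT_comp => //.
  exact: measurable_dot.
Qed.

HB.instance Definition _ := Measure_isProbability.Build _ _ _ nu tilt_setT.

End tilt_instances.

Definition tilt (alpha : 'rV[R]_d) : probability (Rd R d) R :=
  tilt_fun alpha Lambda0_lty.

End exponential_family.

Section Lambda0_duality.
Context (R : realType) (d : nat) (mu0 : probability (Rd R d) R).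
Implicit Types psi rho : 'rV[R]_d -> \bar R.

Definition Lambda0_concave psi : Prop :=
  exists2 rho : 'rV[R]_d -> \bar R, (forall y, rho y < +oo) &
    forall x, psi x =
      ereal_inf (range (fun y : 'rV[R]_d => Lambda0 mu0 (x - y)%R - rho y)).

Definition Lambda0_conjugate psi (y : 'rV[R]_d) : \bar R :=
  ereal_inf (range (fun x : 'rV[R]_d => Lambda0 mu0 (x - y)%R - psi x)).

(** Under the finiteness assumption on [Lambda0], the only infinite value that
    can occur below is [-oo], in [psi]. *)
Definition Lambda0_superdifferential psi : set ('rV[R]_d * 'rV[R]_d) :=
  [set ay | forall v, psi v <=
     psi ay.1 + Lambda0 mu0 (v - ay.2)%R - Lambda0 mu0 (ay.1 - ay.2)%R].

(** In [\bar R] the library sets [+oo - +oo = -oo], the convention needed when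
    [psi] is identically [-oo]. *)
Definition phi_of psi (mu : probability (Rd R d) R) : \bar R :=
  ereal_inf (range (fun theta : 'rV[R]_d =>
    lne (\int[mu]_x (expR (- dot theta x))%:E) - Lambda0_conjugate psi theta)).

Definition h_of (alpha theta : 'rV[R]_d) (x : Rd R d) : \bar R :=
  expeR (- (dot theta x)%:E - Lambda0 mu0 (alpha - theta)%R + Lambda0 mu0 alpha).

Definition V_of (nu : V R d) (mu : probability (Rd R d) R) : Prop :=
  forall A, measurable A -> nu A = mu A.

Definition supergradient (phi : probability (Rd R d) R -> \bar R)
    (mu : probability (Rd R d) R) (L : V R d -> R) : Prop :=
  Omega0 mu0 mu /\ exists2 m : V R d, V_of m mu &
    forall (nu : probability (Rd R d) R) (n : V R d),
      Omega0 mu0 nu -> V_of n nu -> phi nu <= phi mu + (L (n - m)%R)%:E.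

End Lambda0_duality.

Section representation.
Context (R : realType) (d : nat).

Definition is_density (mu : probability (Rd R d) R) (nu : V R d)
    (g : Rd R d -> \bar R) : Prop :=
  mu.-integrable setT g /\
  forall A, measurable A -> nu A = \int[mu]_(x in A) g x.

(** The integral is a difference of integrals of the positive and negative
    parts with [+oo - +oo = -oo], so that the equality, whose left-hand side is
    a real number, entails the integrability of [g] with respect to [p]. *)
Definition represents (mu : probability (Rd R d) R) (L : V R d -> R)
    (p : probability (Rd R d) R) : Prop :=
  forall (nu : V R d) (g : Rd R d -> \bar R),
    nu `<< mu -> is_density mu nu g -> (L nu)%:E = \int[p]_x g x.

End representation.

(* Main.v *)
(** Since psi(alpha) is finite (unless psi is identically -oo), the
    superdifferential condition says that the infimum defining
    psi^0(theta) is attained at alpha. Hence phi(nu) is at most log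
    nu(e^{-<theta,x>}) - psi^0(theta) = log nu(h) + psi(alpha) -
    Lambda0(alpha) with h = h_alpha, and phi(mu_alpha) >= psi(alpha) -
    Lambda0(alpha) always holds. As mu_alpha(h) = 1, the inequality log t
    <= t - 1 turns this into the supergradient inequality for the
    functional nu |-> nu(h). That functional is continuous because h is
    bounded by a multiple of the sum over i of exp(j |x_i|) for j large.
    Finally h d(mu_alpha) = d(mu_{alpha - theta}), so nu(h) is the
    integral of the density of nu against mu_{alpha - theta}; restrictions
    of mu_alpha to Borel sets lie in V and show that no other probability
    measure represents the functional. *)

Require Import Defs.
From HB Require Import structures.
From mathcomp Require Import all_boot all_order all_algebra.
From mathcomp Require Import all_classical all_reals all_analysis.
From mathcomp Require Import measurable_realfun ring lra.
From mathcomp Require finmap.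

Set Implicit Arguments.
Unset Strict Implicit.
Unset Printing Implicit Defensive.

Import Order.TTheory GRing.Theory Num.Theory.
Import numFieldNormedType.Exports.

Local Open Scope classical_set_scope.
Local Open Scope ring_scope.
Local Open Scope ereal_scope.

(** * Integration against a measure given by a density *)

Section density.
Context d0 (T : measurableType d0) (R : realType).
Implicit Types (f g : T -> \bar R) (mu nu : {measure set T -> \bar R}).

Import HBNNSimple.

(** Multiplication is not continuous at [(0, +oo)]; monotonicity of [u] makes up
    for it. *)
Lemma ge0_cvgeZr (u : (\bar R)^nat) (a b : \bar R) :
  {homo u : m n / (m <= n)%N >-> m <= n} -> (forall n, 0 <= u n) -> 0 <= b ->
  u n @[n --> \oo] --> a -> u n * b @[n --> \oo] --> a * b.
Proof.
move=> ndu u0 b0 ua.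
have [->|/eqP by_] := pselect (b = +oo); last first.
  by apply: cvgeZr => //; rewrite ge0_fin_numE// lt_neqAle leey andbT.
have ule n : u n <= a.
  rewrite -(cvg_lim _ ua)// (cvg_lim _ (ereal_nondecreasing_cvgn ndu))//.
  by apply: ereal_sup_ubound; exists n.
have : 0 <= a by exact: le_trans (u0 0%N) (ule 0%N).
rewrite le_eqVlt => /predU1P[a0|a0].
  have -> : (fun n => u n * +oo) = cst (a * +oo).
    apply/funext => n /=; congr (_ * _); apply/eqP.
    by rewrite eq_le ule -a0 u0.
  exact: cvg_cst.
apply: cvg_near_cst; rewrite gt0_muley//.
have : \forall n \near \oo, 0 < u n.
  exact: (ua _ (open_ereal_gt' a0)).
by apply: filterS => n un; rewrite gt0_muley.
Qed.

(** Change of measure with an explicit density: the hypothesis on [nu] is the case of indicators,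
    sums of these give simple functions, and monotone convergence of both sides along [h n] gives
    [f]. *)
Lemma ge0_integral_densityT mu nu f g :
  (forall x, 0 <= f x) -> measurable_fun setT f ->
  (forall x, 0 <= g x) -> measurable_fun setT g ->
  (forall A, measurable A -> nu A = \int[mu]_(x in A) g x) ->
  \int[nu]_x f x = \int[mu]_x (f x * g x).
Proof.
move=> f0 mf g0 mg nug; pose h := nnsfun_approx measurableT mf.
have hnd x : {homo (fun n => (h n x)%:E) : m n / (m <= n)%N >-> m <= n}.
  by move=> a b ab; rewrite lee_fin; exact/lefP/nd_nnsfun_approx.
have hf x : (h n x)%:E @[n --> \oo] --> f x by exact: cvg_nnsfun_approx.
transitivity (limn (fun n => \int[nu]_x (h n x)%:E)).
  rewrite -monotone_convergence//=.
  - by apply: eq_integral => x _; apply/esym/cvg_lim.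
  - by move=> n; exact/measurable_EFinP.
  - by move=> n x _; rewrite lee_fin.
transitivity (limn (fun n => \int[mu]_x ((h n x)%:E * g x))); last first.
  rewrite -monotone_convergence//=.
  - apply: eq_integral => x _; apply/cvg_lim => //.
    by apply: (ge0_cvgeZr (hnd x) _ (g0 x) (hf x)) => n; rewrite lee_fin.
  - by move=> n; apply: emeasurable_funM => //; exact/measurable_EFinP.
  - by move=> n x _; rewrite mule_ge0// lee_fin.
  - by move=> x _ a b ab; rewrite lee_wpmul2r//; exact: hnd.
congr (lim (_ @ \oo)); apply/funext => n.
transitivity (\int[nu]_x
    (\sum_(y \in range (h n)) (y * \1_(h n @^-1` [set y]) x)%:E)).
  by apply: eq_integral => t _; rewrite /= fimfunE -fsumEFin.
rewrite ge0_integral_fsum//; last 2 first.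
  - by move=> r; apply/measurable_EFinP; exact: measurable_funM.
  - by move=> r x _; rewrite nnfun_muleindic_ge0.
transitivity (\int[mu]_x
    (\sum_(y \in range (h n)) (y * \1_(h n @^-1` [set y]) x)%:E * g x));
    last first.
  apply: eq_integral => t _; rewrite [in RHS]fimfunE -fsumEFin//.
  rewrite ge0_mule_fsuml// => r; exact: nnfun_muleindic_ge0.
rewrite ge0_integral_fsum//; last 2 first.
  - move=> r; apply: emeasurable_funM => //.
    by apply/measurable_EFinP; exact: measurable_funM.
  - by move=> r x _; rewrite mule_ge0// nnfun_muleindic_ge0.
(* One level set of [h n] at a time: its [nu]-measure is an integral of [g] by [nug]. *)
apply: eq_fsbigr => r /[!inE] -[t _ <-].
rewrite integralZl_indic_nnsfun//= integral_indic// setIT nug//.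
under [RHS]eq_integral do rewrite EFinM -muleA.
rewrite ge0_integralZl//=; last 3 first.
- by apply: emeasurable_funM => //; exact/measurable_EFinP.
- by move=> x _; rewrite mule_ge0// lee_fin.
- by rewrite lee_fin.
congr (_ * _); rewrite integral_mkcond; apply: eq_integral => x _.
rewrite epatch_indic muleC//.
Qed.

Lemma ge0_integral_density mu nu f g (D : set T) :
  (forall x, 0 <= f x) -> measurable_fun setT f ->
  (forall x, 0 <= g x) -> measurable_fun setT g ->
  (forall A, measurable A -> nu A = \int[mu]_(x in A) g x) ->
  measurable D ->
  \int[nu]_(x in D) f x = \int[mu]_(x in D) (f x * g x).
Proof.
move=> f0 mf g0 mg nug mD; rewrite integral_mkcond.
rewrite (@ge0_integral_densityT mu _ _ g)//.
- rewrite [RHS]integral_mkcond; apply: eq_integral => x _.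
  by rewrite /patch; case: ifPn => // _; rewrite mul0e.
- by move=> x; exact: erestrict_ge0.
- by apply/(measurable_restrictT f mD); exact: measurable_funTS.
Qed.

End density.

(** * Integrals against signed measures *)

Section charge_integral_theory.
Context d0 (T : measurableType d0) (R : realType).
Implicit Types (f g : T -> \bar R) (mu : {measure set T -> \bar R}).
Implicit Type nu : {charge set T -> \bar R}.

Lemma integral_total_variation nu f :
  (forall x, 0 <= f x) -> measurable_fun setT f ->
  \int[Defs.total_variation nu]_x f x =
  \int[jordan_pos (hahnP nu)]_x f x + \int[jordan_neg (hahnP nu)]_x f x.
Proof.
move=> f0 mf; rewrite -ge0_integral_measure_add//.
by apply: eq_measure_integral => A mA _; rewrite [RHS]measure_addE.
Qed.

Lemma charge_integral_fin_num nu f :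
  (forall x, 0 <= f x) -> measurable_fun setT f ->
  \int[Defs.total_variation nu]_x f x < +oo ->
  charge_integral nu f \is a fin_num.
Proof.
move=> f0 mf; rewrite integral_total_variation// => fy.
rewrite fin_numB !ge0_fin_numE ?integral_ge0//.
by apply/andP; split; apply: le_lt_trans fy;
  rewrite ?leeDl ?leeDr ?integral_ge0.
Qed.

Lemma abse_charge_integral_le nu f :
  (forall x, 0 <= f x) -> measurable_fun setT f ->
  `|charge_integral nu f| <= \int[Defs.total_variation nu]_x f x.
Proof.
move=> f0 mf; rewrite integral_total_variation//.
rewrite (le_trans (lee_abs_sub _ _))// !gee0_abs ?integral_ge0//.
Qed.

(** The measures m1 + n and p + m2 agree. Integrating [f] against both and subtracting the two
    finite integrals gives the claim, even when the integrals against [m1] and [p] are infinite. *)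
Lemma eq_diff_integral (m1 m2 p n : {measure set T -> \bar R}) f :
  (forall A, measurable A -> m1 A - m2 A = p A - n A) ->
  (forall A, measurable A -> m2 A \is a fin_num) ->
  (forall A, measurable A -> n A \is a fin_num) ->
  (forall x, 0 <= f x) -> measurable_fun setT f ->
  \int[m2]_x f x < +oo -> \int[n]_x f x < +oo ->
  \int[m1]_x f x - \int[m2]_x f x = \int[p]_x f x - \int[n]_x f x.
Proof.
move=> mpn m2fin nfin f0 mf f2 fn.
have : \int[p]_x f x + \int[m2]_x f x = \int[m1]_x f x + \int[n]_x f x.
  rewrite -!ge0_integral_measure_add//; apply: eq_measure_integral => A mA _.
  rewrite -[LHS]/(measure_add _ _ A) -[RHS]/(measure_add _ _ A) !measure_addE.
  have := measure_ge0 p A; have := measure_ge0 m1 A.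
  move: (m2fin _ mA) (nfin _ mA) (mpn _ mA).
  move: (n A) (p A) (m2 A) (m1 A) => [a| |]// [b| |]// [c| |]// [e| |]//= _ _.
  by rewrite -!EFinB -!EFinD => -[] E _ _; congr EFin; lra.
have : \int[m2]_x f x \is a fin_num by rewrite ge0_fin_numE// integral_ge0.
have : \int[n]_x f x \is a fin_num by rewrite ge0_fin_numE// integral_ge0.
have : 0 <= \int[m1]_x f x by rewrite integral_ge0.
have : 0 <= \int[p]_x f x by rewrite integral_ge0.
move: (\int[m1]_x f x) (\int[m2]_x f x) (\int[p]_x f x) (\int[n]_x f x).
move=> [a| |]// [b| |]// [c| |]// [e| |]//= _ _ _ _.
by rewrite -!EFinB -!EFinD => -[] E; congr EFin; lra.
Qed.

(** Any decomposition of [nu] into a difference of measures may replace the Jordan one, even if [m1]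
    and [m2] are not mutually singular. This matters because the Jordan parts of a sum are not the
    sums of the Jordan parts. *)
Lemma charge_integralE nu (m1 m2 : {measure set T -> \bar R}) f :
  (forall A, measurable A -> nu A = m1 A - m2 A) ->
  (forall A, measurable A -> m2 A \is a fin_num) ->
  (forall x, 0 <= f x) -> measurable_fun setT f ->
  \int[Defs.total_variation nu]_x f x < +oo ->
  \int[m2]_x f x < +oo ->
  charge_integral nu f = \int[m1]_x f x - \int[m2]_x f x.
Proof.
move=> num m2fin f0 mf + f2; rewrite integral_total_variation// => fy.
apply: eq_diff_integral => //.
- move=> A mA; rewrite -num//.
  by rewrite (jordan_decomp (hahnP nu) mA) /cadd/= cscaleN1.
- by move=> A mA; exact: fin_num_measure.
- by apply: le_lt_trans fy; rewrite leeDr ?integral_ge0.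
Qed.

(** The parts of [g] induce two measures [m1] and [m2] with difference [nu], to which
    [charge_integralE] applies. *)
Lemma charge_integral_density mu nu f g :
  mu.-integrable setT g ->
  (forall A, measurable A -> nu A = \int[mu]_(x in A) g x) ->
  (forall x, 0 <= f x) -> measurable_fun setT f ->
  \int[Defs.total_variation nu]_x f x < +oo ->
  charge_integral nu f =
    \int[mu]_x (f x * g^\+ x) - \int[mu]_x (f x * g^\- x).
Proof.
move=> ig nug f0 mf fy.
have mg : measurable_fun setT g by exact: measurable_int ig.
have mgp := measurable_funepos mg; have mgn := measurable_funeneg mg.
have igp := integrable_funepos measurableT ig.
have ign := integrable_funeneg measurableT ig.
have p0 A : 0 <= induced_charge igp A by apply: integral_ge0.
have n0 A : 0 <= induced_charge ign A by apply: integral_ge0.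
pose m1 := measure_of_charge (induced_charge igp) p0.
pose m2 := measure_of_charge (induced_charge ign) n0.
(* Domination by the total variation transfers integrability of [f] to [m2]. The set [B] is where
   [g] is negative: there the positive part of [g] vanishes, and on the rest of [A] the negative
   part does. *)
have m2le A : measurable A -> m2 A <= Defs.total_variation nu A.
  move=> mA; pose B := A `&` [set x | g x < 0].
  have mB : measurable B.
    rewrite /B -(setTI [set x | g x < 0]).
    by apply: measurableI => //; exact: emeasurable_fun_infty_o.
  have -> : m2 A = - nu B.
    rewrite nug// integralE (@integral0_eq _ _ _ _ B g^\+); last first.
      by move=> x [_ /= gx]; rewrite funeposE; apply/max_idPr/ltW.
    rewrite sub0e oppeK -[LHS]/(\int[mu]_(x in A) g^\- x) /B integral_mkcondr.
    apply: eq_integral => x xA; rewrite /patch; case: ifPn => // /negP gx.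
    rewrite funenegE; apply/max_idPr; rewrite leeNl oppe0 leNgt.
    by apply/negP => gx0; apply: gx; rewrite inE.
  have := abse_total_variation nu mB; rewrite -abseN => nuB.
  apply: le_trans (lee_abs _) (le_trans nuB _).
  by apply: le_measure; rewrite ?inE//; exact: subIsetl.
have f2 : \int[m2]_x f x < +oo.
  apply: le_lt_trans fy; exact: ge0_le_measure_integral.
rewrite (@charge_integralE nu m1 m2)//.
- congr (_ - _); last exact: ge0_integral_densityT.
  exact: ge0_integral_densityT.
- by move=> A mA; rewrite nug// integralE.
- by move=> A mA; exact: (fin_num_measure (induced_charge ign)).
Qed.

End charge_integral_theory.

(** * Continuous linear functionals on [V], and elements of [V] *)

Section V_functionals.
Context (R : realType) (d : nat).
Local Notation V := (V R d).

(** Sums and multiples of the Jordan parts decompose the sums and multiples of charges, so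
    [charge_integralE] reduces linearity to that of the integral in the measure. Integrability
    against every total variation keeps all terms finite. *)
Lemma charge_integral_linear (f : Rd R d -> \bar R) :
  (forall x, 0 <= f x) -> measurable_fun setT f ->
  (forall nu : V, \int[Defs.total_variation nu]_x f x < +oo) ->
  exists L : {linear V -> R^o}, forall nu, (L nu)%:E = charge_integral nu f.
Proof.
move=> f0 mf fV.
have fin (nu : V) : charge_integral nu f \is a fin_num.
  by apply: charge_integral_fin_num.
pose I (nu : V) : R^o := fine (charge_integral nu f).
have IE nu : (I nu)%:E = charge_integral nu f by rewrite /I fineK.
have Ip (nu : V) : \int[jordan_pos (hahnP nu)]_x f x < +oo.
  apply: le_lt_trans (fV nu); rewrite integral_total_variation//.
  by rewrite leeDl// integral_ge0.
have In (nu : V) : \int[jordan_neg (hahnP nu)]_x f x < +oo.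
  apply: le_lt_trans (fV nu); rewrite integral_total_variation//.
  by rewrite leeDr// integral_ge0.
have Infin (nu : V) : \int[jordan_neg (hahnP nu)]_x f x \is a fin_num.
  by rewrite ge0_fin_numE ?In// integral_ge0.
have jordanE (nu : V) A : measurable A ->
    nu A = jordan_pos (hahnP nu) A - jordan_neg (hahnP nu) A.
  by move=> mA; rewrite (jordan_decomp (hahnP nu) mA) /cadd/= cscaleN1.
have jfin (nu : V) A : measurable A -> jordan_neg (hahnP nu) A \is a fin_num.
  by move=> mA; exact: fin_num_measure.
have pfin (nu : V) A : measurable A -> jordan_pos (hahnP nu) A \is a fin_num.
  by move=> mA; exact: fin_num_measure.
have addI nu1 nu2 : I (nu1 + nu2)%R = (I nu1 + I nu2)%R.
  apply: EFin_inj; rewrite EFinD !IE.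
  rewrite (@charge_integralE _ _ _ _
    (measure_add (jordan_pos (hahnP nu1)) (jordan_pos (hahnP nu2)))
    (measure_add (jordan_neg (hahnP nu1)) (jordan_neg (hahnP nu2))))//.
  - rewrite !ge0_integral_measure_add// fin_num_oppeD ?Infin// /charge_integral.
    by rewrite addeACA.
  - move=> A mA; rewrite -[LHS]/(nu1 A + nu2 A) !jordanE//.
    rewrite -[X in _ = X - _]/(measure_add _ _ A).
    rewrite -[X in _ = _ - X]/(measure_add _ _ A) !measure_addE.
    by rewrite fin_num_oppeD ?jfin// addeACA.
  - move=> A mA; rewrite -[X in X \is a fin_num]/(measure_add _ _ A).
    rewrite measure_addE.
    by rewrite fin_numD !jfin.
  - by rewrite ge0_integral_measure_add//; apply: lte_add_pinfty; exact: In.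
have scaleI (a : R) nu : I (a *: nu)%R = (a * I nu)%R.
  apply: EFin_inj; rewrite EFinM !IE.
  have [a0|/ltW a0] := leP 0%R a.
    rewrite (@charge_integralE _ _ _ _
      (mscale (NngNum a0) (jordan_pos (hahnP nu)))
      (mscale (NngNum a0) (jordan_neg (hahnP nu))))//.
    + rewrite !ge0_integral_mscale// /charge_integral [RHS]muleBr//.
      by rewrite fin_num_adde_defl// fin_numN Infin.
    + move=> A mA; rewrite -[LHS]/(a%:E * nu A) jordanE//.
      by rewrite /mscale/= muleBr// fin_num_adde_defl// fin_numN jfin.
    + by move=> A mA; rewrite /mscale/= fin_numM// jfin.
    + by rewrite ge0_integral_mscale//= lte_mul_pinfty.
  (* A negative factor exchanges the roles of the two Jordan parts. *)
  have Na0 : (0 <= - a)%R by rewrite oppr_ge0.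
  rewrite (@charge_integralE _ _ _ _
    (mscale (NngNum Na0) (jordan_neg (hahnP nu)))
    (mscale (NngNum Na0) (jordan_pos (hahnP nu))))//.
  + rewrite !ge0_integral_mscale// /charge_integral.
    rewrite [in RHS]muleBr// ?fin_num_adde_defl ?fin_numN ?Infin//.
    by rewrite -[LHS]/((- a)%:E * _ - (- a)%:E * _) EFinN !mulNe oppeK addeC.
  + move=> A mA; rewrite -[LHS]/(a%:E * nu A) jordanE//.
    rewrite /mscale/= muleBr// ?fin_num_adde_defl ?fin_numN ?jfin//.
    by rewrite -[RHS]/((- a)%:E * _ - (- a)%:E * _) EFinN !mulNe oppeK addeC.
  + by move=> A mA; rewrite /mscale/= fin_numM// pfin.
  + by rewrite ge0_integral_mscale//= lte_mul_pinfty.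
have linI : linear I by move=> a u v; rewrite addI scaleI.
pose m := GRing.isLinear.Build _ _ _ _ I linI.
pose L : {linear V -> R^o} := HB.pack I m.
by exists L.
Qed.

Lemma open_pV_ball (i : 'I_d) (j : nat) (nu0 : V) (e : R) : (0 < e)%R ->
  open [set nu : V | pV i j (nu - nu0)%R < e%:E].
Proof.
move=> e0; set B := [set nu : V | _].
(* Open sets are unions of finite intersections of subbasic sets; here both the union and the
   intersection have [B] as their only member. *)
exists [set B]; last by rewrite bigcup_set1.
move=> _ ->; exists (finmap.fset1 B); last by rewrite set_fset1 bigcap_set1.
move=> C; rewrite finmap.in_fset1 => /eqP ->; apply/mem_set.
by exists i, j, nu0, e.
Qed.

Lemma near_pV (j : nat) (nu0 : V) (e : R) : (0 < e)%R ->
  \forall nu \near nu0, forall i : 'I_d, pV i j (nu - nu0)%R < e%:E.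
Proof.
move=> e0; apply: (@filter_forall V 'I_d
  (fun i => [set nu : V | pV i j (nu - nu0)%R < e%:E]) (nbhs nu0)) => i.
apply: open_nbhs_nbhs; split; first exact: open_pV_ball.
suff : pV i j (nu0 - nu0 : V)%R < e%:E by [].
rewrite subrr.
by rewrite -[X in X < _]/(pV i j czero) pV_zero lte_fin.
Qed.

(** A linear functional dominated by finitely many of the seminorms is continuous: the bound is
    applied to [nu - nu0] on an intersection of seminorm balls. *)
Lemma V_linear_continuous (L : {linear V -> R^o}) (j : nat) (C : R) :
  (0 <= C)%R ->
  (forall nu, `|L nu|%:E <= C%:E * \sum_(i < d) pV i j nu) ->
  continuous (L : V -> R^o).
Proof.
move=> C0 LC nu0.
apply/(@cvgrPdist_lt _ _ _ (nbhs nu0) (nbhs_filter nu0)) => e e0.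
pose D : R := d%:R; have D0 : (0 <= D)%R by [].
(* The bound will be C * d * e'. Adding 1 to both factors makes the denominator positive and leaves
   the positive slack e' * (C + D + 1) below [e]. *)
pose e' := (e / ((C + 1) * (D + 1)))%R.
have CD0 : (0 < (C + 1) * (D + 1))%R by rewrite mulr_gt0// ltr_wpDl.
have e'0 : (0 < e')%R by rewrite divr_gt0.
apply: (@filterS _ (nbhs nu0) _ _ _ _ (near_pV j nu0 e'0)) => nu nuE.
rewrite distrC -linearB -lte_fin; apply: le_lt_trans (LC _) _.
apply: (@le_lt_trans _ _ (C%:E * \sum_(i < d) e'%:E)).
  by rewrite lee_wpmul2l// lee_sum// => i _; exact/ltW.
rewrite sumEFin sumr_const card_ord -EFinM lte_fin -mulr_natr.
have -> : e = (e' * ((C + 1) * (D + 1)))%R by rewrite /e' divfK ?gt_eqF.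
rewrite -subr_gt0 (_ : _ - _ = e' * (C + D + 1))%R; last by rewrite /D; ring.
by rewrite mulr_gt0//; lra.
Qed.

Lemma V_of_finite_measure (m : {finite_measure set (Rd R d) -> \bar R}) :
  (forall (i : 'I_d) (j : nat),
    \int[m]_x (expR (j%:R * `|x ord0 i|))%:E < +oo) ->
  exists n : V, forall A, measurable A -> n A = m A.
Proof.
move=> my.
(* [crestr0] agrees with [m] on measurable sets and is 0 on all others, as [V_junk] demands. *)
pose c := crestr0 (charge_of_finite_measure m) measurableT.
have cE A : measurable A -> c A = m A.
  by move=> mA; rewrite /c /crestr0 mem_set//= /crestr setIT.
have cjunk A : ~ measurable A -> c A = 0.
  by move=> mA; rewrite /c /crestr0 memNset.
have cy i j : pV i j c < +oo.
  apply: le_lt_trans (my i j); apply: ge0_le_measure_integral => //.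
  - apply: Defs.total_variation_le => A mA.
    by rewrite -[X in `|X| <= _]/(c A) cE// gee0_abs.
  - exact: measurable_expV.
by exists (MkV cjunk cy) => A mA; rewrite -cE.
Qed.

(** The pairing is at most the l1 norm of [a] times the largest |x_i|, and the exponential for that
    index is one of the summands. For d = 0 the sum would be empty and the bound false. *)
Lemma expR_dot_le (a : 'rV[R]_d) : (0 < d)%N ->
  exists j : nat, forall x : 'rV[R]_d,
    (expR (dot a x) <= \sum_(i < d) expR (j%:R * `|x ord0 i|))%R.
Proof.
move=> d0; pose M := (\sum_(i < d) `|a ord0 i|)%R.
have M0 : (0 <= M)%R by apply: sumr_ge0.
exists (Num.bound M) => x.
pose k := [arg max_(i > Ordinal d0) `|x ord0 i|%R]%O.
have kmax i : (`|x ord0 i| <= `|x ord0 k|)%R.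
  by rewrite /k; case: arg_maxP => // m _; apply.
rewrite (bigD1 k)//= ler_wpDr//.
  by apply: sumr_ge0 => i _; exact: expR_ge0.
rewrite ler_expR; apply: (@le_trans _ _ (M * `|x ord0 k|)%R); last first.
  by rewrite ler_wpM2r// ltW// archi_boundP.
rewrite /dot /M mulr_suml; apply: ler_sum => i _.
by rewrite (le_trans (ler_norm _))// normrM ler_wpM2l.
Qed.

End V_functionals.

(** * The pairing on R^d *)

Section dot.
Context (R : realType) (d : nat).
Implicit Types a b x : 'rV[R]_d.

Lemma dotDl a b x : dot (a + b)%R x = (dot a x + dot b x)%R.
Proof.
by rewrite /dot -big_split; apply: eq_bigr => i _; rewrite mxE mulrDl.
Qed.

Lemma dotNl a x : dot (- a)%R x = (- dot a x)%R.
Proof. by rewrite /dot -sumrN; apply: eq_bigr => i _; rewrite mxE mulNr. Qed.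

Lemma dotZ_delta (c : R) (i : 'I_d) x :
  dot (c *: delta_mx ord0 i)%R x = (c * x ord0 i)%R.
Proof.
rewrite /dot (bigD1 i)//= big1 ?addr0 => [|k ki].
  by rewrite !mxE !eqxx mulr1.
by rewrite !mxE (negbTE ki) andbF mulr0 mul0r.
Qed.

Lemma measurable_expR_dot a :
  measurable_fun setT (fun x : Rd R d => (expR (dot a x))%:E).
Proof.
apply/measurable_EFinP; apply: measurableT_comp => //; exact: measurable_dot.
Qed.

End dot.

(** * The exponential family and the function [h_of] *)

Section tilt_theory.
Context (R : realType) (d : nat) (mu0 : probability (Rd R d) R).
Hypothesis Lambda0_lty : forall t : 'rV[R]_d, Lambda0 mu0 t < +oo.
Local Notation tilt := (tilt Lambda0_lty).
Local Notation lam t := (fine (Lambda0 mu0 t)).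
Implicit Types a t alpha theta : 'rV[R]_d.

Lemma fine_Lambda0K t : (lam t)%:E = Lambda0 mu0 t.
Proof. by rewrite fineK// Lambda0_fin_num. Qed.

Lemma integral_tilt alpha (f : Rd R d -> \bar R) (D : set (Rd R d)) :
  (forall x, 0 <= f x) -> measurable_fun setT f -> measurable D ->
  \int[tilt alpha]_(x in D) f x =
  \int[mu0]_(x in D) (f x * tilt_density mu0 alpha x).
Proof.
move=> f0 mf mD; apply: ge0_integral_density => //.
- by move=> x; exact: expeR_ge0.
- exact: measurable_tilt_density.
Qed.

Lemma tilt_densityE alpha x :
  tilt_density mu0 alpha x = (expR (dot alpha x - lam alpha))%:E.
Proof. by rewrite /tilt_density -fine_Lambda0K. Qed.

(** The exponentials multiply, so the cumulant generating function of [tilt alpha] is [Lambda0]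
    translated by [alpha] and normalized to vanish at 0. *)
Lemma integral_tilt_expR_dot alpha t :
  \int[tilt alpha]_x (expR (dot t x))%:E =
  expeR (Lambda0 mu0 (alpha + t)%R - Lambda0 mu0 alpha).
Proof.
rewrite integral_tilt//; last exact: measurable_expR_dot.
transitivity (\int[mu0]_x
    ((expR (- lam alpha))%:E * (expR (dot (alpha + t)%R x))%:E)).
  apply: eq_integral => x _; rewrite tilt_densityE -!EFinM -!expRD dotDl.
  by congr (expR _)%:E; ring.
rewrite ge0_integralZl//; [|exact: measurable_expR_dot].
by rewrite expint_Lambda0// expeRD muleC -(fine_Lambda0K alpha).
Qed.

(** From exp(j|s|) <= exp(js) + exp(-js) at s = x_i: both terms are exponentials of linear forms,
    with finite integrals. This puts [tilt alpha] in [V]. *)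
Lemma tilt_expR_coord_lty alpha (i : 'I_d) (j : nat) :
  \int[tilt alpha]_x (expR (j%:R * `|x ord0 i|))%:E < +oo.
Proof.
pose e (c : R) := (c *: delta_mx ord0 i : 'rV[R]_d)%R.
have ely c : \int[tilt alpha]_x (expR (dot (e c) x))%:E < +oo.
  rewrite integral_tilt_expR_dot.
  rewrite -(fine_Lambda0K alpha) -(fine_Lambda0K (alpha + e c)%R).
  by rewrite -EFinB ltry.
apply: (@le_lt_trans _ _ (\int[tilt alpha]_x
    ((expR (dot (e j%:R) x))%:E + (expR (dot (e (- j%:R)%R) x))%:E))).
  apply: ge0_le_integral => //.
  - exact: measurable_expV.
  - by apply: emeasurable_funD; exact: measurable_expR_dot.
  - move=> x _; rewrite -EFinD lee_fin /e !dotZ_delta mulNr -mulrN.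
    by have [_|_] := ger0P (x ord0 i); rewrite ?lerDl ?lerDr expR_ge0.
rewrite ge0_integralD//; [|exact: measurable_expR_dot..].
by apply: lte_add_pinfty; exact: ely.
Qed.

Lemma h_ofE alpha theta x : h_of mu0 alpha theta x =
  (expR (lam alpha - lam (alpha - theta)%R))%:E * (expR (- dot theta x))%:E.
Proof.
rewrite /h_of -(fine_Lambda0K alpha) -(fine_Lambda0K (alpha - theta)%R).
rewrite -EFinM -expRD /=.
move: (lam alpha) (lam (alpha - theta)%R) (dot theta x) => r s u.
by congr (expR _)%:E; ring.
Qed.

Lemma h_of_ge0 alpha theta x : 0 <= h_of mu0 alpha theta x.
Proof. exact: expeR_ge0. Qed.

Lemma measurable_h_of alpha theta : measurable_fun setT (h_of mu0 alpha theta).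
Proof.
have -> : h_of mu0 alpha theta = fun x =>
    (expR (lam alpha - lam (alpha - theta)%R))%:E *
    (expR (dot (- theta)%R x))%:E.
  by apply/funext => x; rewrite h_ofE dotNl.
by apply: emeasurable_funM => //; exact: measurable_expR_dot.
Qed.

(** Multiplying [h_of] by the density of [tilt alpha] cancels [Lambda0 mu0 alpha] and leaves the
    density of [tilt (alpha - theta)]. *)
Lemma integral_tilt_h_of alpha theta A : measurable A ->
  \int[tilt alpha]_(x in A) h_of mu0 alpha theta x = tilt (alpha - theta)%R A.
Proof.
move=> mA; rewrite integral_tilt//; last 2 first.
- exact: h_of_ge0.
- exact: measurable_h_of.
apply: eq_integral => x _.
rewrite h_ofE !tilt_densityE -!EFinM -!expRD dotDl dotNl.
move: (lam alpha) (lam (alpha - theta)%R) (dot theta x) (dot alpha x).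
move=> r s u v; congr (expR _)%:E; ring.
Qed.

(** The pointwise bound [expR_dot_le] at [- theta], integrated; [C] is the constant factor of
    [h_of]. It yields both finiteness and continuity of the functional. *)
Lemma integral_h_of_le alpha theta : (0 < d)%N ->
  exists (j : nat) (C : R), (0 <= C)%R /\ forall nu : V R d,
    \int[Defs.total_variation nu]_x h_of mu0 alpha theta x <=
    C%:E * \sum_(i < d) pV i j nu.
Proof.
move=> d0; have [j jP] := expR_dot_le (- theta) d0.
exists j, (expR (lam alpha - lam (alpha - theta)%R)); split => [|nu].
  exact: expR_ge0.
rewrite -ge0_integral_sum//; last first.
  by move=> i; exact: measurable_expV.
rewrite -ge0_integralZl//; last 2 first.
- by apply: emeasurable_sum => i; exact: measurable_expV.
- by move=> x _; apply: sume_ge0.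
apply: ge0_le_integral => //.
- by move=> x _; exact: h_of_ge0.
- exact: measurable_h_of.
- apply: emeasurable_funM => //.
  by apply: emeasurable_sum => i; exact: measurable_expV.
- move=> x _; rewrite h_ofE lee_wpmul2l// sumEFin lee_fin -dotNl; exact: jP.
Qed.

Lemma integral_h_of_lty alpha theta (nu : V R d) : (0 < d)%N ->
  \int[Defs.total_variation nu]_x h_of mu0 alpha theta x < +oo.
Proof.
move=> d0; have [j [C [C0 /(_ nu)]]] := integral_h_of_le alpha theta d0.
move=> /le_lt_trans; apply; rewrite lte_mul_pinfty//.
by apply: lte_sum_pinfty => i _; exact: V_lty.
Qed.

Lemma charge_integral_V_of (nu : V R d) (m : probability (Rd R d) R)
    (f : Rd R d -> \bar R) : V_of nu m ->
  (forall x, 0 <= f x) -> measurable_fun setT f ->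
  \int[Defs.total_variation nu]_x f x < +oo ->
  charge_integral nu f = \int[m]_x f x.
Proof.
move=> num f0 mf fy; rewrite (@charge_integralE _ _ _ _ m mzero)//.
- by rewrite integral_measure_zero sube0.
- by move=> A mA; rewrite num// /mzero sube0.
- by rewrite integral_measure_zero.
Qed.

Lemma tilt_in_Omega0 alpha : Omega0 mu0 (tilt alpha).
Proof.
apply/null_content_dominatesP => A mA A0.
rewrite /= /tilt_fun; apply: null_set_integral => //.
by apply: measurable_funTS; exact: measurable_tilt_density.
Qed.

Lemma V_of_tilt alpha : exists n : V R d, V_of n (tilt alpha).
Proof. by apply: V_of_finite_measure => i j; exact: tilt_expR_coord_lty. Qed.

End tilt_theory.

(** This is log t <= t - 1 at t = exp(c) * i; for i <= 0 the left side is -oo. *)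
Lemma lne_le_scale (R : realType) (i c : R) :
  lne i%:E <= (expR c * i - c - 1)%:E.
Proof.
have [i0|i0] := leP i 0%R; first by rewrite le0_lneNy ?lee_fin// leNye.
rewrite lne_EFin// lee_fin.
have := expR_ge1Dx (c + ln i)%R; rewrite expRD lnK ?posrE//; lra.
Qed.

(** * Conjugacy, the supergradient inequality and the representing measure *)

Section duality.
Context (R : realType) (d : nat) (mu0 : probability (Rd R d) R).
Hypothesis Lambda0_lty : forall t : 'rV[R]_d, Lambda0 mu0 t < +oo.
Variables (psi : 'rV[R]_d -> \bar R) (alpha theta : 'rV[R]_d).
Local Notation tilt := (tilt Lambda0_lty).
Local Notation lam t := (fine (Lambda0 mu0 t)).
Hypothesis alpha_theta : Lambda0_superdifferential mu0 psi (alpha, theta).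

Let lamK t : (lam t)%:E = Lambda0 mu0 t.
Proof. exact: fine_Lambda0K. Qed.

(** The superdifferential inequality then forces [psi] to be -oo everywhere, so the infimum runs
    over the single value +oo. *)
Lemma Lambda0_conjugate_superdifferential_Ny :
  psi alpha = -oo -> Lambda0_conjugate mu0 psi theta = +oo.
Proof.
move=> psia; apply/ereal_inf_pinfty => _ [v _ <-] /=.
have := alpha_theta v; rewrite /= psia.
by rewrite leeNy_eq => /eqP ->; rewrite -lamK.
Qed.

Lemma Lambda0_conjugate_superdifferential_ge (a : R) : psi alpha = a%:E ->
  (lam (alpha - theta)%R - a)%:E <= Lambda0_conjugate mu0 psi theta.
Proof.
move=> psia; apply: le_ereal_inf_tmp => _ [v _ <-].
have := alpha_theta v; rewrite /= psia.
rewrite -(lamK (alpha - theta)%R) -(lamK (v - theta)%R).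
move: (lam (alpha - theta)%R) (lam (v - theta)%R) => r s.
case: (psi v) => [b| |]//=; last by rewrite leey.
by rewrite -!EFinD !lee_fin; lra.
Qed.

(** For each [t], testing the conjugate at [alpha] gives psi^0(t) <= Lambda0(alpha - t) - a, and
    Lambda0(alpha - t) cancels against the log-integral of [tilt alpha]. *)
Lemma phi_of_tilt_ge (a : R) : psi alpha = a%:E ->
  (a - lam alpha)%:E <= phi_of mu0 psi (tilt alpha).
Proof.
move=> psia; apply: le_ereal_inf_tmp => _ [t _ <-].
under eq_integral do rewrite -dotNl.
rewrite integral_tilt_expR_dot expeRK.
have : Lambda0_conjugate mu0 psi t <= Lambda0 mu0 (alpha - t)%R - a%:E.
  by apply: ereal_inf_lbound; exists alpha; rewrite ?psia.
rewrite -(lamK (alpha - t)%R) -(lamK alpha).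
move: (lam (alpha - t)%R) (lam alpha) => r s.
case: (Lambda0_conjugate mu0 psi t) => [b| |]//=; last by rewrite leey.
by rewrite -!EFinD !lee_fin; lra.
Qed.

Lemma supergradient_h_of (L : {linear V R d -> R^o}) : (0 < d)%N ->
  psi alpha < +oo ->
  (forall nu, (L nu)%:E = charge_integral nu (h_of mu0 alpha theta)) ->
  supergradient mu0 (phi_of mu0 psi) (tilt alpha) L.
Proof.
move=> d0 psiay LE; split; first exact: tilt_in_Omega0.
have [m mE] := V_of_tilt Lambda0_lty alpha; exists m => // nu n _ nE.
have LV k (p : probability (Rd R d) R) : V_of k p ->
    (L k)%:E = \int[p]_x h_of mu0 alpha theta x.
  move=> kp; rewrite LE (charge_integral_V_of kp)//.
  - exact: h_of_ge0.
  - exact: measurable_h_of.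
  - exact: integral_h_of_lty.
have Lm : L m = 1%R.
  apply: EFin_inj; rewrite (LV _ _ mE) integral_tilt_h_of//.
  exact: probability_setT.
(* With this [c], [h_of] is exp(c) times exp(-<theta,x>). *)
pose c := (lam alpha - lam (alpha - theta)%R)%R.
pose I := \int[nu]_x (expR (- dot theta x))%:E.
have mexp : measurable_fun setT (fun x : Rd R d => (expR (- dot theta x))%:E).
  by under eq_fun do rewrite -dotNl; exact: measurable_expR_dot.
have Ln : (L n)%:E = (expR c)%:E * I.
  rewrite (LV _ _ nE) -ge0_integralZl//.
  by apply: eq_integral => x _; rewrite h_ofE.
(* [I] is finite because it is a positive multiple of the real number [L n]. *)
have [i iE] : exists i : R, I = i%:E.
  exists (expR (- c) * L n)%R.
  by rewrite EFinM Ln muleA -EFinM -expRD addNr expR0 mul1e.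
have {}Ln : L n = (expR c * i)%R by apply: EFin_inj; rewrite Ln iE.
have phin : phi_of mu0 psi nu <= lne I - Lambda0_conjugate mu0 psi theta.
  by apply: ereal_inf_lbound; exists theta.
apply: le_trans phin _.
(* If [psi alpha] is -oo, the conjugate at [theta] is +oo and the upper bound for [phi_of] is
   -oo. *)
move psia : (psi alpha) psiay => [a| |]// _; last first.
  by rewrite Lambda0_conjugate_superdifferential_Ny// addeNy leNye.
apply: (@le_trans _ _ ((expR c * i - c - 1)%:E -
                       (lam (alpha - theta)%R - a)%:E)).
  rewrite iE; apply: leeB; first exact: lne_le_scale.
  exact: Lambda0_conjugate_superdifferential_ge.
(* Since [L m] is 1, this value equals the preceding bound: the terms [lam (alpha - theta)]
   cancel. *)
apply: (@le_trans _ _ ((a - lam alpha)%:E + (L (n - m)%R)%:E)).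
  have -> : L (n - m)%R = (L n - L m)%R by exact: linearB.
  rewrite Lm Ln -!EFinD lee_fin /c/=.
  move: (lam alpha) (lam (alpha - theta)%R) (expR _ * i)%R => r s u; lra.
by apply: leeD => //; exact: phi_of_tilt_ge.
Qed.

(** By [integral_tilt_h_of], [h_of] is the density of [p] relative to [tilt alpha]; this converts
    the integrals of both parts of [g]. Agreement with the tilt is asked on Borel sets only, since
    values elsewhere are unconstrained. *)
Lemma represents_h_of (L : {linear V R d -> R^o}) (p : probability (Rd R d) R) :
  (0 < d)%N ->
  (forall nu, (L nu)%:E = charge_integral nu (h_of mu0 alpha theta)) ->
  (forall A, measurable A -> p A = tilt (alpha - theta)%R A) ->
  represents (tilt alpha) L p.
Proof.
move=> d0 LE pE nu g _ [ig nug].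
rewrite LE (charge_integral_density ig nug); last 3 first.
- by move=> x; exact: h_of_ge0.
- exact: measurable_h_of.
- exact: integral_h_of_lty.
have mg := measurable_int _ ig.
have pd f : (forall x, 0 <= f x) -> measurable_fun setT f ->
    \int[p]_x f x = \int[tilt alpha]_x (h_of mu0 alpha theta x * f x).
  move=> f0 mf.
  rewrite (@ge0_integral_density _ _ _ (tilt alpha) _ _
    (h_of mu0 alpha theta))//.
  - by apply: eq_integral => x _; rewrite muleC.
  - by move=> x; exact: h_of_ge0.
  - exact: measurable_h_of.
  - by move=> A mA; rewrite integral_tilt_h_of//; exact: pE.
rewrite [RHS]integralE !pd//; last exact: measurable_funepos.
exact: measurable_funeneg.
Qed.

(** The test element is [mu] restricted to [A], with density the indicator of [A]: its image under
    [L] is both [p A] and [q A]. The moment bounds place it in [V]. *)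
Lemma represents_unique (L : V R d -> R) (mu p q : probability (Rd R d) R) :
  (forall (i : 'I_d) (j : nat),
    \int[mu]_x (expR (j%:R * `|x ord0 i|))%:E < +oo) ->
  represents mu L p -> represents mu L q ->
  forall A, measurable A -> p A = q A.
Proof.
move=> muy Lp Lq A mA.
have muA : mu A < +oo by rewrite -ge0_fin_numE// fin_num_measure.
have [n nE] : exists n : V R d, forall B, measurable B -> n B = mu (B `&` A).
  apply: (@V_of_finite_measure _ _ (mfrestr mA muA)) => i j.
  apply: le_lt_trans (muy i j); apply: ge0_le_measure_integral => //.
  - move=> B mB; rewrite -[leLHS]/(mu (B `&` A)).
    apply: le_measure; [|exact/mem_set|exact: subIsetl].
    by apply/mem_set; exact: measurableI.
  - exact: measurable_expV.
have nmu : n `<< mu.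
  apply/null_content_dominatesP => B mB B0; rewrite nE//.
  by apply: subset_measure0 B0 => //; exact: measurableI.
have dA : is_density mu n (EFin \o \1_A).
  split; first exact: integrable_indic.
  by move=> B mB; rewrite nE//= integral_indic// setIC.
have := Lq _ _ nmu dA; rewrite (Lp _ _ nmu dA).
by rewrite /= !integral_indic// !setIT.
Qed.

End duality.

Theorem theorem7 (R : realType) (d : nat) (d_gt0 : (0 < d)%N)
    (mu0 : probability (Rd R d) R)
    (Lambda0_lty : forall t : 'rV[R]_d, Lambda0 mu0 t < +oo)
    (psi : 'rV[R]_d -> \bar R) (psi_lty : forall x, psi x < +oo)
    (psi_concave : Lambda0_concave mu0 psi)
    (alpha theta : 'rV[R]_d)
    (alpha_theta : Lambda0_superdifferential mu0 psi (alpha, theta)) :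
  exists L : {linear V R d -> R^o},
    [/\ continuous (L : V R d -> R^o),
        supergradient mu0 (phi_of mu0 psi) (tilt Lambda0_lty alpha) L,
        forall nu : V R d,
          (L nu)%:E = charge_integral nu (h_of mu0 alpha theta) &
        forall p : probability (Rd R d) R,
          (Omega0 mu0 p /\ represents (tilt Lambda0_lty alpha) L p) <->
          (forall A, measurable A ->
             p A = tilt Lambda0_lty (alpha - theta)%R A)].
Proof.
have h0 := h_of_ge0 mu0 alpha theta.
have mh := measurable_h_of Lambda0_lty alpha theta.
have [L LE] := charge_integral_linear h0 mh
  (fun nu => integral_h_of_lty Lambda0_lty alpha theta nu d_gt0).
have Lq : represents (tilt Lambda0_lty alpha) L
    (tilt Lambda0_lty (alpha - theta)).
  exact: (represents_h_of d_gt0 LE (fun _ _ => erefl)).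
exists L; split => //.
- have [j [C [C0 hC]]] := integral_h_of_le Lambda0_lty alpha theta d_gt0.
  apply: (@V_linear_continuous _ _ _ j C) => // nu.
  apply: le_trans (hC nu); rewrite -abse_EFin LE.
  exact: abse_charge_integral_le.
- exact: (supergradient_h_of Lambda0_lty alpha_theta d_gt0 (psi_lty alpha) LE).
(* One direction compares [p] with the representing measure of [Lq] by uniqueness; the other
   transfers representation and absolute continuity along [pE]. *)
- move=> p; split => [[_ Lp] A mA|pE].
    apply: (represents_unique _ Lp Lq mA) => i j.
    exact: tilt_expR_coord_lty.
  split; last exact: (represents_h_of d_gt0 LE pE).
  apply/null_content_dominatesP => A mA A0; rewrite pE//.
  by have /null_content_dominatesP -> :=
    tilt_in_Omega0 Lambda0_lty (alpha - theta).
Qed.
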